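(* Let $Z^*=V_1/V_2$, let $\phi_1^*:(0,\infty)\to(0,\infty)$ be a measurable function, and let $\delta_{\phi_1^*}=V_2\phi_1^*(Z^* )$ be the corresponding estimator of $\sigma_2$. Let $\beta^*$ be the unique solution of $E[L'(\beta^*U)]=0$, where $U\sim \mathrm{Gamma}(b-a+1,1)$. Define $c(1,z^* )=\beta^*(1+z^* )$ and $\phi_{2,1}(z^* )=\max\{\phi_1^*(z^* ),c(1,z^* )\}$. If $P_\eta\big(\phi_1^*(Z^* )<c(1,Z^* )\big)\neq0$ for some $\eta>0$, then the estimator $\delta_{\phi_{2,1}}=V_2\phi_{2,1}(Z^* )$ of $\sigma_2$ has uniformly smaller risk than $\delta_{\phi_1^*}$ under the scale invariant loss $L$, that is, $R(\theta,\delta_{\phi_{2,1}})<R(\theta,\delta_{\phi_1^*})$ for all $\theta$.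
   Context: Fix integers $1\le a_i<b_i\le n_i$, $i=1,2$, and put $a=a_1+a_2$, $b=b_1+b_2$. The unknown parameter is $\theta=(\mu_1,\mu_2,\sigma_1,\sigma_2)$ with $\mu_1,\mu_2\in\mathbb{R}$ and $0<\sigma_1\le\sigma_2$; $\eta=\sigma_1/\sigma_2\in(0,1]$. From a random sample of size $n_i$ from the exponential distribution with density $\sigma_i^{-1}e^{-(x-\mu_i)/\sigma_i}$, $x>\mu_i$, one observes only the order statistics of ranks $a_i,\dots,b_i$ (doubly type-II censored sample). A complete sufficient statistic is $(X_{a_1},X_{a_2},V_1,V_2)$, consisting of four independent random variables, where $X_{a_i}$ has density $$\frac{n_i!}{(a_i-1)!(n_i-a_i)!}\Big[1-e^{-\frac{x-\mu_i}{\sigma_i}}\Big]^{a_i-1}\frac1{\sigma_i}\Big[e^{-\frac{x-\mu_i}{\sigma_i}}\Big]^{n_i-a_i+1},\quad x>\mu_i,$$ and $V_i$ has the gamma distribution with shape $b_i-a_i$ and scale $\sigma_i$. $\mathrm{Gamma}(k,1)$ denotes the gamma distribution with shape $k$ and scale $1$. The loss for estimating $\sigma_2$ by $\delta$ is $L(\delta/\sigma_2)$, where $L$ is differentiable and: (i) $L(t)$ is bowl-shaped with minimum value $0$ attained at $t=1$, decreasing for $t\le1$ and increasing for $t\ge1$; (ii) all integrals involving $L$ are finite and differentiation under the integral sign is permissible. The risk is $R(\theta,\delta)=E_\theta L(\delta/\sigma_2)$. The law of $Z^*=V_1/V_2$ depends on $\theta$ only through $\eta$; $P_\eta$ denotes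 probability under $\eta$. *)

(* Defs.v *)
From HB Require Import structures.
From mathcomp Require Import all_boot all_order all_algebra.
From mathcomp Require Import all_classical all_reals all_analysis.

Set Implicit Arguments.
Unset Strict Implicit.
Unset Printing Implicit Defensive.

Import Order.TTheory GRing.Theory Num.Theory.
Import numFieldNormedType.Exports.

Local Open Scope classical_set_scope.
Local Open Scope ring_scope.

Record param (R : realType) := Param {
  mu1 : R; mu2 : R; sigma1 : R; sigma2 : R }.

Definition admissible (R : realType) (theta : param R) : Prop :=
  0 < sigma1 theta /\ sigma1 theta <= sigma2 theta.

Definition eta (R : realType) (theta : param R) : R :=
  sigma1 theta / sigma2 theta.

(* The shape k is a positive integer, so that Gamma(k) = (k-1)!. *)
Definition gamma_pdf (R : realType) (k : nat) (s x : R) : R :=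
  if 0 < x then x ^+ k.-1 * expR (- (x / s)) / (s ^+ k * (k.-1)`!%:R) else 0.

Definition order_stat_pdf (R : realType) (n a : nat) (mu sigma x : R) : R :=
  if mu < x then
    n`!%:R / ((a.-1)`!%:R * (n - a)`!%:R)
    * (1 - expR (- ((x - mu) / sigma))) ^+ a.-1
    * sigma^-1
    * expR (- ((x - mu) / sigma)) ^+ (n - a).+1
  else 0.

Definition has_density d (T : measurableType d) (R : realType)
    (P : probability T R) (X : {mfun T >-> R}) (f : R -> R) : Prop :=
  forall A : set R, measurable A ->
    distribution P X A = (\int[lebesgue_measure]_(x in A) (f x)%:E)%E.

(* Taking some of the A_i equal to setT gives the product rule for every
   subfamily. *)
Definition independent4 d (T : measurableType d) (R : realType)
    (P : probability T R) (X1 X2 X3 X4 : {mfun T >-> R}) : Prop :=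
  forall A1 A2 A3 A4 : set R,
    measurable A1 -> measurable A2 -> measurable A3 -> measurable A4 ->
    P (X1 @^-1` A1 `&` X2 @^-1` A2 `&` X3 @^-1` A3 `&` X4 @^-1` A4) =
    (P (X1 @^-1` A1) * P (X2 @^-1` A2) * P (X3 @^-1` A3) * P (X4 @^-1` A4))%E.

(* XA1 and XA2 are the smallest observed order statistics X_{a_1}, X_{a_2}. *)
Definition censored_exponential_model d (T : measurableType d) (R : realType)
    (n1 n2 a1 a2 b1 b2 : nat) (P : param R -> probability T R)
    (XA1 XA2 V1 V2 : {mfun T >-> R}) : Prop :=
  forall theta, admissible theta ->
    [/\ has_density (P theta) XA1
          (order_stat_pdf n1 a1 (mu1 theta) (sigma1 theta)),
        has_density (P theta) XA2
          (order_stat_pdf n2 a2 (mu2 theta) (sigma2 theta)),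
        has_density (P theta) V1 (gamma_pdf (b1 - a1) (sigma1 theta)),
        has_density (P theta) V2 (gamma_pdf (b2 - a2) (sigma2 theta)) &
        independent4 (P theta) XA1 XA2 V1 V2].

(* The event, of probability 1 under every admissible parameter, on which
   V1 / V2 lies in the domain of the functions phi and the estimators are
   defined. *)
Definition positive_part d (T : measurableType d) (R : realType)
    (V1 V2 : {mfun T >-> R}) : set T := [set w | 0 < V1 w /\ 0 < V2 w].

Definition Zstar d (T : measurableType d) (R : realType)
    (V1 V2 : {mfun T >-> R}) (w : T) : R := V1 w / V2 w.

Definition delta d (T : measurableType d) (R : realType)
    (V1 V2 : {mfun T >-> R}) (phi : R -> R) (w : T) : R :=
  V2 w * phi (Zstar V1 V2 w).

Definition risk d (T : measurableType d) (R : realType)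
    (P : param R -> probability T R) (V1 V2 : {mfun T >-> R}) (L : R -> R)
    (theta : param R) (phi : R -> R) : \bar R :=
  (\int[P theta]_(w in positive_part V1 V2)
     (L (delta V1 V2 phi w / sigma2 theta))%:E)%E.

(* Losses are functions on (0, +oo); their values at t <= 0 are irrelevant. *)
Definition bowl_shaped_loss (R : realType) (L : R -> R) : Prop :=
  [/\ forall t, 0 < t -> derivable L t 1,
      L 1 = 0,
      forall s t, 0 < s -> s <= t -> t <= 1 -> L t <= L s &
      forall s t, 1 <= s -> s <= t -> L s <= L t].

Definition gamma_integrable (R : realType) (k : nat) (f : R -> R) : Prop :=
  lebesgue_measure.-integrable `]0, +oo[
    (fun u : R => (f u * gamma_pdf k 1 u)%:E).

(* E[f(U)] for U ~ Gamma(k, 1). *)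
Definition gamma_mean (R : realType) (k : nat) (f : R -> R) : R :=
  \int[lebesgue_measure]_(u in `]0, +oo[) (f u * gamma_pdf k 1 u).

(* Finiteness of E[L(cV)] and E[L'(cU)] for V ~ Gamma(k, 1) and
   U ~ Gamma(k+1, 1), and d/dc E[L(cV)] = E[V L'(cV)]; other scales reduce to
   scale 1 by rescaling c. *)
Definition regular_loss (R : realType) (k : nat) (L : R -> R) : Prop :=
  forall c : R, 0 < c ->
    [/\ gamma_integrable k (fun v => L (c * v)),
        gamma_integrable k.+1 (fun u => derive1 L (c * u)) &
        is_derive c 1 (fun x : R => gamma_mean k (fun v => L (x * v)))
          (gamma_mean k (fun v => v * derive1 L (c * v)))].

Definition unique_positive_root_of_mean (R : realType) (k : nat) (L : R -> R)
    (beta : R) : Prop :=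
  [/\ 0 < beta,
      gamma_mean k (fun u => derive1 L (beta * u)) = 0 &
      forall c, 0 < c -> gamma_mean k (fun u => derive1 L (c * u)) = 0 -> c = beta].

(* c(1, z) *)
Definition c1 (R : realType) (beta z : R) : R := beta * (1 + z).

Definition phi21 (R : realType) (beta : R) (phi1 : R -> R) (z : R) : R :=
  Num.max (phi1 z) (c1 beta z).

(* Main.v *)
Require Import Defs.
From mathcomp Require Import all_boot all_order all_algebra.
From mathcomp Require Import all_classical all_reals all_analysis.
From mathcomp Require Import measurable_realfun ring.

(** Conditionally on [V1 / V2 = z], [V2] is Gamma distributed with shape
    [k = b - a] and rate [z / sigma1 + 1 / sigma2], so the risk of [V2 phi(V1 / V2)]
    is the integral over [z > 0] of a positive weight times
    [g (phi z / (1 + z / eta))], where [g c = E L(c V)] with [V ~ Gamma(k, 1)].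
    The function [g] decreases strictly on [(0, beta]]: [g' c = k E L'(c U)]
    with [U ~ Gamma(k+1, 1)], and this is negative for [c < beta] since, after
    the substitution [t = c u], it has the sign of the integral of
    [L'(t) t^k exp(-(t - 1) / c)], whose integrand is nondecreasing in [c]
    because [L'(t)] and [t - 1] have the same sign. As [eta <= 1],
    [c(1, z) = beta (1 + z) <= beta (1 + z / eta)]; hence replacing a value of
    [phi1] below [c(1, z)] by [c(1, z)] lowers the conditional risk. *)

Import Order.TTheory GRing.Theory Num.Theory.
Import numFieldNormedType.Exports.

Local Open Scope classical_set_scope.
Local Open Scope ring_scope.

Set Implicit Arguments.
Unset Strict Implicit.

(** * Dilations of Lebesgue measure, and integrals against laws with densities *)

Lemma lebesgue_measure_dilation (R : realType) (c : R) (A : set R) :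
  0 < c -> measurable A ->
  lebesgue_measure A =
    (c%:E * lebesgue_measure ((fun x => c * x)%R @^-1` A))%E.
Proof.
move=> c0 mA.
have mc : measurable_fun [set: measurableTypeR R]
    (fun x : measurableTypeR R => c * x : measurableTypeR R).
  exact: mulrl_measurable.
(* Lebesgue measure is determined by its values on the intervals []a, b]], so it suffices that [mm],
   which is [c] times the image of Lebesgue measure under [x |-> c * x], gives them length
   [b - a]. *)
pose mm := mscale (NngNum (ltW c0))
    (pushforward (@lebesgue_measure R) (fun x : R => c * x : measurableTypeR R))
  : {measure set (measurableTypeR R) -> \bar R}.
rewrite (@lebesgue_measure_unique R (mm mc)) // => _ [[a b]] _ <- /=.
rewrite /mm /mscale /= /pushforward.
have -> : (fun x => c * x) @^-1` `]a, b]%classic = `]a / c, b / c]%classic.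
  apply/seteqP; split => x /=; rewrite !in_itv/= ltr_pdivrMr// ler_pdivlMr//.
    by rewrite mulrC.
  by rewrite mulrC.
rewrite !lebesgue_measure_itv/= !lte_fin ltr_pM2r ?invr_gt0//.
case: ifPn => _; last by rewrite mule0.
by rewrite -!EFinD -EFinM mulrDr mulrN !(mulrC c) !divfK ?gt_eqF.
Qed.

Lemma ge0_integral_dilation (R : realType) (c : R) (f : R -> \bar R) :
  0 < c -> measurable_fun setT f -> (forall x, 0 <= f x)%E ->
  (\int[lebesgue_measure]_x f (c * x)%R = c^-1%:E * \int[lebesgue_measure]_x f x)%E.
Proof.
move=> c0 mf f0.
have mc : measurable_fun [set: measurableTypeR R]
    (fun x : measurableTypeR R => c * x : measurableTypeR R).
  exact: mulrl_measurable.
pose mm := mscale (NngNum (ltW c0))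
    (pushforward (@lebesgue_measure R) (fun x : R => c * x : measurableTypeR R))
  : {measure set (measurableTypeR R) -> \bar R}.
rewrite [X in (_ * X)%E](@eq_measure_integral _ _ _ _ (mm mc)) => [|A mA _].
  rewrite /mm ge0_integral_mscale// muleA -EFinM /= mulVf ?gt_eqF// mul1e.
  by rewrite ge0_integral_pushforward.
exact: lebesgue_measure_dilation.
Qed.

(* [R] and [measurableTypeR R] have the same measurable sets but different
   displays, and [lebesgue_measure] is a measure on the latter. *)
Lemma ge0_integral_density d (T : measurableType d) (R : realType)
    (P : probability T R) (X : {mfun T >-> measurableTypeR R}) (p : R -> R)
    (f : R -> \bar R) :
  (forall A : set R, measurable A ->
    distribution P X A = (\int[lebesgue_measure]_(x in A) (p x)%:E)%E) ->
  measurable_fun [set: R] p -> (forall x, 0 <= p x) ->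
  measurable_fun [set: R] f -> (forall x, 0 <= f x)%E ->
  (\int[distribution P X]_x f x = \int[lebesgue_measure]_x (f x * (p x)%:E))%E.
Proof.
move=> dX mp p0 mf f0.
(* Absolute continuity provides a Radon-Nikodym derivative. It agrees with [p] almost everywhere
   because both integrate to the law of [X] on every measurable set. *)
have ac : distribution P X `<< (@lebesgue_measure R).
  apply/null_content_dominatesP => A mA A0; rewrite dX //.
  rewrite null_set_integral//.
  exact/measurable_EFinP/measurable_funTS.
rewrite -(@Radon_Nikodym_SigmaFinite.change_of_variables _ _ _ (distribution P X)
  (@lebesgue_measure R))//.
apply: ae_eq_integral => //.
- apply: emeasurable_funM => //.
  exact/(measurable_int _ (Radon_Nikodym_SigmaFinite.f_integrable _)).
- by apply: emeasurable_funM => //; exact/measurable_EFinP.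
apply: ae_eqe_mul2l.
apply: integral_ae_eq => //.
- exact: (Radon_Nikodym_SigmaFinite.f_integrable _).
- exact/measurable_EFinP.
- by move=> E _ mE; rewrite -Radon_Nikodym_SigmaFinite.f_integral//; exact: dX.
Qed.

(** Independence on rectangles identifies the joint law with the product of the marginal laws.
    Tonelli then gives an iterated integral, in which each law is replaced by its density. *)
Lemma ge0_integral_indep_density d (T : measurableType d) (R : realType)
    (P : probability T R) (X Y : {mfun T >-> R}) (p q : R -> R)
    (F : R * R -> \bar R) :
  has_density P X p -> has_density P Y q ->
  measurable_fun [set: R] p -> (forall x, 0 <= p x) ->
  measurable_fun [set: R] q -> (forall x, 0 <= q x) ->
  (forall A B : set R, measurable A -> measurable B ->
     P (X @^-1` A `&` Y @^-1` B) = (P (X @^-1` A) * P (Y @^-1` B))%E) ->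
  measurable_fun [set: R * R] F -> (forall z, 0 <= F z)%E ->
  (\int[P]_w F (X w, Y w) =
   \int[lebesgue_measure]_y ((\int[lebesgue_measure]_x (F (x, y) * (p x)%:E))
      * (q y)%:E))%E.
Proof.
move=> dX dY mp p0 mq q0 XY mF F0.
have mX : measurable_fun [set: T] (X : T -> measurableTypeR R) by exact: (measurable_funP X).
have mY : measurable_fun [set: T] (Y : T -> measurableTypeR R) by exact: (measurable_funP Y).
pose X' : {mfun T >-> measurableTypeR R} := @mfun_Sub _ _ T (measurableTypeR R) X (mem_set mX).
pose Y' : {mfun T >-> measurableTypeR R} := @mfun_Sub _ _ T (measurableTypeR R) Y (mem_set mY).
have mXY : measurable_fun setT (fun w => (X' w, Y' w)) by exact: measurable_fun_pair.
transitivity (\int[pushforward P (fun w => (X' w, Y' w))]_z F z)%E.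
  by rewrite ge0_integral_pushforward// => y _; exact: F0.
transitivity (\int[distribution P X' \x distribution P Y']_z F z)%E.
  apply: eq_measure_integral => A mA _.
  apply/esym; apply: product_measure_unique; last by [].
  by move=> B C mB mC; exact: XY.
transitivity (\int[distribution P Y']_y fubini_G (distribution P X') F y)%E.
  exact: fubini_tonelli2.
have dX' (A : set R) : measurable A ->
  distribution P X' A = (\int[lebesgue_measure]_(x in A) (p x)%:E)%E by exact: dX.
have dY' (A : set R) : measurable A ->
  distribution P Y' A = (\int[lebesgue_measure]_(x in A) (q x)%:E)%E by exact: dY.
rewrite (ge0_integral_density dY')//.
- apply: eq_integral => y _; rewrite /fubini_G (ge0_integral_density dX')//.
  exact: measurableT_comp.
- exact: measurable_fun_fubini_tonelli_G.
- by move=> y; apply: integral_ge0.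
Qed.

(** * The ratio of two independent gamma variables *)

Lemma gamma_pdf_ge0 (R : realType) (k : nat) (s x : R) : 0 < s -> 0 <= gamma_pdf k s x.
Proof.
rewrite /gamma_pdf => s0; case: ifPn => // x0.
by rewrite divr_ge0 ?mulr_ge0 ?expR_ge0 ?exprn_ge0 ?ler0n ?ltW.
Qed.

Lemma gamma_pdf_le0 (R : realType) (k : nat) (s x : R) : x <= 0 -> gamma_pdf k s x = 0.
Proof. by rewrite /gamma_pdf leNgt => /negbTE ->. Qed.

Lemma measurable_gamma_pdf (R : realType) (k : nat) (s : R) :
  measurable_fun [set: R] (gamma_pdf k s).
Proof.
apply: measurable_fun_ifT => //; first exact: measurable_fun_ltr.
apply: measurable_funM => //; apply: measurable_funM => //.
apply: measurableT_comp => //; apply: measurableT_comp => //.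
exact: measurable_funM.
Qed.

(** For fixed [y > 0] the substitution [x = y * z] has Jacobian [y]. Tonelli then moves the ratio
    [z] to the outer integral, which amounts to conditioning on it. *)
Lemma ge0_integral_ratio d (T : measurableType d) (R : realType)
    (P : probability T R) (X Y : {mfun T >-> R}) (p q : R -> R)
    (G : R * R -> \bar R) :
  has_density P X p -> has_density P Y q ->
  measurable_fun [set: R] p -> (forall x, 0 <= p x) ->
  measurable_fun [set: R] q -> (forall x, 0 <= q x) ->
  (forall x, x <= 0 -> p x = 0) -> (forall x, x <= 0 -> q x = 0) ->
  (forall A B : set R, measurable A -> measurable B ->
     P (X @^-1` A `&` Y @^-1` B) = (P (X @^-1` A) * P (Y @^-1` B))%E) ->
  measurable_fun [set: R * R] G -> (forall z, 0 <= G z)%E ->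
  (\int[P]_(w in positive_part X Y) G (Zstar X Y w, Y w) =
   \int[lebesgue_measure]_z \int[lebesgue_measure]_y
     (G (z, y) * (p (y * z) * y * q y)%R%:E))%E.
Proof.
move=> dX dY mp p0 mq q0 pneg qneg XY mG G0.
(* [powR _ (-1)] is the inverse on the positive reals and, unlike [^-1], has a
   measurability lemma on the whole line. *)
pose F (z : R * R) : \bar R :=
  if (0 < z.1) && (0 < z.2) then G (z.1 * z.2 `^ (-1), z.2) else 0%E.
have F0 z : (0 <= F z)%E by rewrite /F; case: ifP.
have mF : measurable_fun [set: R * R] F.
  apply: measurable_fun_ifT => //.
    by apply: measurable_and; apply: measurable_fun_ltr.
  apply: measurableT_comp => //; apply/measurable_fun_pairP; split => //=.
    apply: measurable_funM => //.
    exact: (measurableT_comp (measurable_powR (-1)) measurable_snd).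
  exact: measurable_snd.
transitivity (\int[P]_w F (X w, Y w))%E.
  rewrite integral_mkcond; apply: eq_integral => w _; rewrite patchE /F /=.
  case: ifPn; rewrite ?inE /positive_part /=.
    by move=> [X0 Y0]; rewrite X0 Y0/= /Zstar powR_inv1 ?ltW.
  by rewrite notin_setE /= => /asboolP; case: ifPn => // /andP[-> ->] /asboolP [].
rewrite (ge0_integral_indep_density dX dY)//.
pose K (z : R * R) : \bar R := (G z * (p (z.2 * z.1) * z.2 * q z.2)%R%:E)%E.
have K0 z : (0 <= K z)%E.
  rewrite /K mule_ge0// lee_fin.
  have [z0|z0] := leP z.2 0; first by rewrite qneg// mulr0.
  by rewrite !mulr_ge0// ltW.
have mK : measurable_fun [set: R * R] K.
  apply: emeasurable_funM => //; apply/measurable_EFinP.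
  apply: measurable_funM; last exact: measurableT_comp.
  apply: measurable_funM => //; apply: measurableT_comp => //.
  exact: measurable_funM.
transitivity (\int[lebesgue_measure]_y \int[lebesgue_measure]_z K (z, y))%E; last first.
  exact/esym/(@fubini_tonelli _ _ _ _ _ (@lebesgue_measure R) (@lebesgue_measure R)).
apply: eq_integral => y _.
(* For [y <= 0] both sides vanish with [q y]; the substitution is needed only for [y > 0]. *)
have [y0|y0] := leP y 0.
  rewrite qneg// mule0 integral0_eq// => z _.
  by rewrite /K qneg//= mulr0 mule0.
have mFy : measurable_fun [set: R] (fun x => F (x, y) * (p x)%:E)%E.
  apply: emeasurable_funM; last exact/measurable_EFinP.
  exact: measurableT_comp.
rewrite (_ : (fun z => K (z, y)) =
    (fun z => (y * q y)%R%:E * (F ((y * z)%R, y) * (p (y * z)%R)%:E))%E); last first.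
  apply/funext => z; rewrite /K /F /= y0 pmulr_rgt0// andbT.
  (* For [z <= 0], [F] is zero on the right, while on the left [p (y * z)] vanishes. *)
  case: ifPn => [z0|]; last first.
    by rewrite -leNgt => z0; rewrite pneg ?mul0r ?mule0// pmulr_rle0.
  rewrite powR_inv1 ?ltW// [(y * z)%R]mulrC mulfK ?gt_eqF// muleCA -EFinM.
  by congr (_ * _%:E)%E; ring.
rewrite ge0_integralZl_EFin//; last 3 first.
- by move=> z _; rewrite mule_ge0// lee_fin.
- exact: (measurableT_comp mFy (mulrl_measurable y)).
- by rewrite mulr_ge0// ltW.
rewrite (@ge0_integral_dilation _ _ (fun x => F (x, y) * (p x)%:E)%E)//; last first.
  by move=> z; rewrite mule_ge0// lee_fin.
rewrite muleA -EFinM muleC; congr (_%:E * _)%E.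
by rewrite mulrAC mulfV ?mul1r ?gt_eqF.
Qed.

(** The inverse scale of the gamma law of [Y] given [X / Y = z], obtained by adding the exponents
    [y * z / s1] and [y / s2]. *)
Definition ratio_rate (R : realType) (s1 s2 z : R) : R := z / s1 + s2^-1.

(* The density at [z > 0] of [X / Y] (a scaled beta prime law) for independent
   [X ~ Gamma(k1, s1)] and [Y ~ Gamma(k2, s2)]. *)
Definition ratio_weight (R : realType) (k1 k2 : nat) (s1 s2 z : R) : R :=
  z ^+ k1.-1 * (k1 + k2).-1`!%:R
  / (s1 ^+ k1 * s2 ^+ k2 * (k1.-1)`!%:R * (k2.-1)`!%:R)
  / ratio_rate s1 s2 z ^+ (k1 + k2).

Lemma ratio_rate_gt0 (R : realType) (s1 s2 z : R) :
  0 < s1 -> 0 < s2 -> 0 < z -> 0 < ratio_rate s1 s2 z.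
Proof.
by move=> s10 s20 z0; rewrite /ratio_rate addr_gt0 ?divr_gt0// invr_gt0.
Qed.

Lemma ratio_weight_gt0 (R : realType) (k1 k2 : nat) (s1 s2 z : R) :
  0 < s1 -> 0 < s2 -> 0 < z -> 0 < ratio_weight k1 k2 s1 s2 z.
Proof.
move=> s10 s20 z0; have r0 := ratio_rate_gt0 s10 s20 z0.
by rewrite /ratio_weight !(divr_gt0, mulr_gt0, exprn_gt0)// ltr0n fact_gt0.
Qed.

(** The powers of [y] add up to [k1 + k2 - 1] and the exponentials merge into one of rate
    [ratio_rate]. The extra factor [ratio_rate] is the Jacobian of [u = ratio_rate * y], so that
    [ratio_weight] remains as the density of the ratio. *)
Lemma gamma_pdf_ratioE (R : realType) (k1 k2 : nat) (s1 s2 z y : R) :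
  (0 < k1)%N -> (0 < k2)%N -> 0 < s1 -> 0 < s2 -> 0 < z ->
  gamma_pdf k1 s1 (y * z) * y * gamma_pdf k2 s2 y =
  ratio_weight k1 k2 s1 s2 z * ratio_rate s1 s2 z *
    gamma_pdf (k1 + k2) 1 (ratio_rate s1 s2 z * y).
Proof.
move=> k10 k20 s10 s20 z0; have r0 := ratio_rate_gt0 s10 s20 z0.
have [y0|y0] := leP y 0.
  rewrite (@gamma_pdf_le0 _ k2)// (@gamma_pdf_le0 _ (k1 + k2)) ?mulr0//.
  by rewrite pmulr_rle0.
rewrite /gamma_pdf y0 !pmulr_rgt0// z0 y0.
have -> : expR (- (ratio_rate s1 s2 z * y / 1)) =
    expR (- (y * z / s1)) * expR (- (y / s2)).
  by rewrite -expRD; congr expR; rewrite /ratio_rate; field; rewrite !gt_eqF.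
rewrite /ratio_weight; set r := ratio_rate s1 s2 z in r0 *.
case: k1 k10 => // k1 _; case: k2 k20 => // k2 _.
rewrite addSn addnS /= !exprMn expr1n.
set e1 := expR _; set e2 := expR _.
have f1 : (k1`!%:R : R) != 0 by rewrite gt_eqF// ltr0n fact_gt0.
have f2 : (k2`!%:R : R) != 0 by rewrite gt_eqF// ltr0n fact_gt0.
have f3 : ((k1 + k2).+1`!%:R : R) != 0 by rewrite gt_eqF// ltr0n fact_gt0.
move: f1 f2 f3; set f1 := k1`!%:R; set f2 := k2`!%:R; set f3 := _.+1`!%:R => f1n f2n f3n.
have a1 : s1 ^+ k1.+1 != 0 by rewrite expf_neq0 ?gt_eqF.
have a2 : s2 ^+ k2.+1 != 0 by rewrite expf_neq0 ?gt_eqF.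
have a3 : r ^+ (k1 + k2).+1 != 0 by rewrite expf_neq0 ?gt_eqF.
rewrite (exprS r (k1 + k2).+1) (exprS y (k1 + k2)) exprD.
field.
by rewrite f1n f2n f3n a1 a2 a3 gt_eqF.
Qed.

Lemma ge0_integral_gamma_ratio d (T : measurableType d) (R : realType)
    (P : probability T R) (X Y : {mfun T >-> R}) (k1 k2 : nat) (s1 s2 : R)
    (G : R * R -> \bar R) :
  (0 < k1)%N -> (0 < k2)%N -> 0 < s1 -> 0 < s2 ->
  has_density P X (gamma_pdf k1 s1) -> has_density P Y (gamma_pdf k2 s2) ->
  (forall A B : set R, measurable A -> measurable B ->
     P (X @^-1` A `&` Y @^-1` B) = (P (X @^-1` A) * P (Y @^-1` B))%E) ->
  measurable_fun [set: R * R] G -> (forall z, 0 <= G z)%E ->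
  (\int[P]_(w in positive_part X Y) G (Zstar X Y w, Y w) =
   \int[lebesgue_measure]_(z in `]0%R, +oo[) ((ratio_weight k1 k2 s1 s2 z)%:E *
     \int[lebesgue_measure]_u
       (G (z, u / ratio_rate s1 s2 z)%R * (gamma_pdf (k1 + k2) 1 u)%:E)))%E.
Proof.
move=> k10 k20 s10 s20 dX dY XY mG G0.
rewrite (ge0_integral_ratio dX dY)//; last 6 first.
- exact: measurable_gamma_pdf.
- by move=> x; exact: gamma_pdf_ge0.
- exact: measurable_gamma_pdf.
- by move=> x; exact: gamma_pdf_ge0.
- by move=> x; exact: gamma_pdf_le0.
- by move=> x; exact: gamma_pdf_le0.
rewrite [RHS]integral_mkcond; apply: eq_integral => z _.
rewrite patchE; case: ifPn; rewrite ?inE ?notin_setE /= in_itv/= andbT; last first.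
  (* For [z <= 0] the integrand is zero for every [y]: the second density vanishes if [y <= 0], the
     first if [y > 0], since then [y * z <= 0]. *)
  move=> /negP; rewrite -leNgt => z0; apply: integral0_eq => y _.
  have [y0|y0] := leP y 0; first by rewrite (@gamma_pdf_le0 _ _ _ y)// mulr0 mule0.
  by rewrite gamma_pdf_le0 ?mul0r ?mule0// pmulr_rle0.
move=> z0; have r0 := ratio_rate_gt0 s10 s20 z0.
set r := ratio_rate s1 s2 z in r0 *; set m := ratio_weight _ _ _ _ _.
have m0 : 0 < m by exact: ratio_weight_gt0.
pose h (u : R) := (G (z, u / r)%R * (gamma_pdf (k1 + k2) 1 u)%:E)%E.
have h0 u : (0 <= h u)%E by rewrite /h mule_ge0// lee_fin gamma_pdf_ge0.
have mh : measurable_fun [set: R] h.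
  apply: emeasurable_funM; last first.
    by apply/measurable_EFinP; exact: measurable_gamma_pdf.
  apply: measurableT_comp => //; apply/measurable_fun_pairP; split => //=.
    exact: measurable_cst.
  exact: (@mulrr_measurable _ _ r^-1).
transitivity (\int[lebesgue_measure]_y ((m * r)%:E * h (r * y)%R))%E.
  apply: eq_integral => y _; rewrite gamma_pdf_ratioE// /h -/r -/m.
  by rewrite [(r * y / r)%R]mulrAC mulfV ?gt_eqF// mul1r EFinM muleCA.
rewrite ge0_integralZl_EFin//; last 2 first.
- exact: (measurableT_comp mh (mulrl_measurable r)).
- by rewrite mulr_ge0// ltW.
by rewrite ge0_integral_dilation// muleA -EFinM mulfK ?gt_eqF//.
Qed.

(** * Signs of the derivative of a bowl-shaped loss *)

Lemma nonincreasing_derive1_le0 (R : realType) (f : R -> R) (a b z : R) :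
  (forall x, a < x < b -> derivable f x 1) ->
  (forall x y, a < x -> x <= y -> y < b -> f y <= f x) ->
  a < z < b -> derive1 f z <= 0.
Proof.
(* [f x - e x] is strictly decreasing, as [decr_derive1_le0_itv] requires. *)
move=> df decf azb; apply/ler_addgt0Pr => e e0; rewrite add0r -subr_le0.
have dg x : a < x < b -> is_derive x 1 (fun x => f x - e * x) (derive1 f x - e).
  move=> /df dfx; have dfx' : is_derive x 1 f (derive1 f x).
    by rewrite derive1E; exact/derivableP.
  by apply: is_derive_eq; rewrite scaler1.
have [_ <-] := dg _ azb.
rewrite -derive1E; apply: (@decr_derive1_le0_itv _ _ false true a b) => [x|x y|].
- by rewrite mem_setE in_itv/= => /dg [].
- rewrite !in_itv/= => /andP[ax xb] /andP[ay yb] yx.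
  by rewrite ler_ltD// ?decf// ?ltW// ltrN2 ltr_pM2l.
- by rewrite in_itv.
Qed.

Lemma bowl_shaped_loss_ge0 (R : realType) (L : R -> R) (t : R) :
  bowl_shaped_loss L -> 0 < t -> 0 <= L t.
Proof.
move=> [_ L1 Ld Li] t0; rewrite -L1.
by have [t1|t1] := leP t 1; [apply: Ld|apply: Li => //; exact: ltW].
Qed.

Lemma bowl_shaped_derive1_le0 (R : realType) (L : R -> R) (t : R) :
  bowl_shaped_loss L -> 0 < t < 1 -> derive1 L t <= 0.
Proof.
move=> [dL _ Ld _] t01.
apply: (@nonincreasing_derive1_le0 _ _ 0 1) => // [x /andP[x0 _]|x y x0 xy y1].
  exact: dL.
by apply: Ld => //; exact: ltW.
Qed.

Lemma bowl_shaped_derive1_ge0 (R : realType) (L : R -> R) (t : R) :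
  bowl_shaped_loss L -> 1 < t -> 0 <= derive1 L t.
Proof.
move=> [dL _ _ Li] t1; rewrite -oppr_le0.
have dLt x : 0 < x -> derive1 (\- L) x = - derive1 L x.
  by move=> x0; rewrite !derive1E deriveN//; exact: dL.
rewrite -dLt ?(lt_trans ltr01)//.
(* The endpoint [t + 1] is an arbitrary bound beyond [t]. *)
apply: (@nonincreasing_derive1_le0 _ _ 1 (t + 1)) => [x /andP[x0 _]|x y x0 xy y1|].
- by apply: derivableN; apply: dL; exact: lt_trans x0.
- by rewrite lerN2; apply: Li => //; exact: ltW.
- by rewrite t1 ltrDl/=.
Qed.

(** * Strict decrease of the mean loss below [beta] *)

Lemma integral_dilation (R : realType) (c : R) (f : R -> \bar R) :
  0 < c -> lebesgue_measure.-integrable setT f ->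
  lebesgue_measure.-integrable setT (fun x => f (c * x)%R) /\
  (\int[lebesgue_measure]_x f (c * x)%R = c^-1%:E * \int[lebesgue_measure]_x f x)%E.
Proof.
move=> c0 intf; have mf := measurable_int _ intf.
have mfc : measurable_fun [set: R] (fun x => f (c * x)%R).
  exact: (measurableT_comp mf (mulrl_measurable c)).
split.
  have /integrableP[_ abs_lty] := intf.
  apply/integrableP; split => //.
  rewrite (@ge0_integral_dilation _ _ (fun x => `|f x|)%E)//.
    by rewrite lte_mul_pinfty// lee_fin invr_ge0 ltW.
  exact: measurableT_comp.
(* The nonnegative case applies to the positive and negative parts; integrability makes the negative
   part finite, so that [c^-1] distributes over the difference. *)
rewrite integralE [in RHS]integralE muleBr//; last first.
  by rewrite fin_num_adde_defl// fin_numN integrable_neg_fin_num.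
rewrite -!ge0_integral_dilation//; [|exact: measurable_funeneg|exact: measurable_funepos].
by congr (_ - _)%E; apply: eq_integral => x _; rewrite ?(funeposE, funenegE).
Qed.

Lemma Rintegral_dilation (R : realType) (c : R) (f : R -> R) :
  0 < c -> lebesgue_measure.-integrable `]0, +oo[ (EFin \o f) ->
  lebesgue_measure.-integrable `]0, +oo[ (fun x => (f (c * x))%:E) /\
  \int[lebesgue_measure]_(x in `]0, +oo[) f (c * x) =
  c^-1 * \int[lebesgue_measure]_(x in `]0, +oo[) f x.
Proof.
move=> c0 intf0; have m0 : measurable (`]0%R, +oo[%classic : set (measurableTypeR R)) by [].

have intf := (integrable_mkcond _ m0).1 intf0.
have [intfc fcE] := integral_dilation c0 intf.
(* The half-line is invariant under positive dilations, so extension by zero commutes with them. *)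
have E : ((fun x => (f (c * x))%:E) \_ `]0%R, +oo[%classic =
    (fun x => ((EFin \o f) \_ `]0%R, +oo[%classic) (c * x)))%R.
  apply/funext => x; rewrite !patchE.
  by rewrite !mem_setE !in_itv/= !andbT pmulr_rgt0.
split; first by apply/(integrable_mkcond _ m0); rewrite E.
rewrite /Rintegral integral_mkcond E fcE -integral_mkcond fineM//.
exact: integrable_fin_num.
Qed.

Lemma gamma_pdfS1E (R : realType) (k : nat) (u : R) : 0 < u ->
  gamma_pdf k.+1 1 u = u ^+ k * expR (- u) / k`!%:R.
Proof. by move=> u0; rewrite /gamma_pdf u0 /= divr1 expr1n mul1r. Qed.

(* With [t = c u], this is [L'(t) exp(-(t - 1) / c) <= L'(t) exp(-(t - 1) / b)]
   up to a positive factor. *)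
Lemma derive1_bowl_shaped_dilation_le (R : realType) (k : nat) (L : R -> R)
    (c b u : R) :
  bowl_shaped_loss L -> 0 < c -> c <= b -> 0 < u ->
  (c / b) ^+ k * expR (c^-1 - b^-1) * (derive1 L (c * u) * gamma_pdf k.+1 1 u) <=
  derive1 L (c * u) * gamma_pdf k.+1 1 (c / b * u).
Proof.
move=> hL c0 cb u0; have b0 : 0 < b := lt_le_trans c0 cb.
have r0 : 0 < c / b by rewrite divr_gt0.
have r1 : c / b <= 1 by rewrite ler_pdivrMr ?mul1r.
rewrite !gamma_pdfS1E ?mulr_gt0 ?invr_gt0//; set r := c / b in r0 r1 *.
have k0 : 0 <= r ^+ k * u ^+ k / k`!%:R.
  by rewrite divr_ge0 ?mulr_ge0 ?exprn_ge0 ?ler0n ?ltW.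
rewrite [(r * u) ^+ k]exprMn -subr_ge0.
rewrite [leRHS](_ : _ = (r ^+ k * u ^+ k / k`!%:R) * (derive1 L (c * u) *
    (expR (- (r * u)) - expR (c^-1 - b^-1 - u)))); last first.
  by rewrite (expRD (c^-1 - b^-1)); ring.
rewrite mulr_ge0// {k0}.
(* The difference of the two exponents has the sign of [c * u - 1], which is also the sign of
   [L'(c * u)]. At [c * u = 1] the exponentials coincide, so no information on [L'(1)] enters. *)
have E : - (r * u) - (c^-1 - b^-1 - u) = (1 - r) / c * (c * u - 1).
  by rewrite /r; field; rewrite !gt_eqF.
have r1c : 0 <= (1 - r) / c by rewrite divr_ge0 ?subr_ge0// ltW.
have [cu1|cu1|cu1] := ltgtP (c * u) 1.
- rewrite mulr_le0// ?subr_le0 ?ler_expR.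
    by apply: bowl_shaped_derive1_le0 => //; rewrite mulr_gt0.
  by rewrite -subr_le0 E mulr_ge0_le0// subr_le0 ltW.
- rewrite mulr_ge0// ?subr_ge0 ?ler_expR.
    exact: bowl_shaped_derive1_ge0.
  by rewrite -subr_ge0 E mulr_ge0// subr_ge0 ltW.
- suff -> : - (r * u) = c^-1 - b^-1 - u by rewrite subrr mulr0.
  by apply/eqP; rewrite -subr_eq0 E cu1 subrr mulr0.
Qed.

(** The pointwise bound is integrated over [u]. Its right-hand side is the integrand at the root [b]
    dilated by [c / b], so its integral is zero and the mean at [c] is at most zero. Equality would
    make [c] a second root. *)
Lemma gamma_mean_derive1_lt0 (R : realType) (k : nat) (L : R -> R) (b c : R) :
  bowl_shaped_loss L ->
  (forall x, 0 < x -> gamma_integrable k.+1 (fun u => derive1 L (x * u))) ->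
  unique_positive_root_of_mean k.+1 L b -> 0 < c -> c < b ->
  gamma_mean k.+1 (fun u => derive1 L (c * u)) < 0.
Proof.
move=> hL intL [b0 Lb0 Lb_unique] c0 cb.
rewrite lt_neqAle; apply/andP; split.
  by apply/eqP => /(Lb_unique _ c0) cbE; rewrite cbE ltxx in cb.
have r0 : 0 < c / b by rewrite divr_gt0.
have [] := Rintegral_dilation (f := fun u => derive1 L (b * u) * gamma_pdf k.+1 1 u)
  r0 (intL _ b0).
rewrite -/(gamma_mean k.+1 (fun u => derive1 L (b * u))) Lb0 mulr0.
move=> int2 mean2.
have K0 : 0 < (c / b) ^+ k * expR (c^-1 - b^-1) by rewrite mulr_gt0 ?exprn_gt0 ?expR_gt0.
rewrite -(pmulr_rle0 _ K0) /gamma_mean -RintegralZl//; last exact: intL.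
rewrite -[leRHS]mean2; apply: le_Rintegral => //.
- have := intL _ c0; rewrite /gamma_integrable => /(integrableZl _ ((c / b) ^+ k * expR (c^-1 - b^-1))).
  by apply.
- move=> u /=; rewrite in_itv/= andbT => u0.
  rewrite [b * _](_ : _ = c * u); last by field; rewrite gt_eqF.
  exact: derive1_bowl_shaped_dilation_le (ltW cb) u0.
Qed.

(** Size-biasing: multiplying the gamma density of shape [k.+1] by [v] gives [k.+1] times the
    density of shape [k.+2]. This is why [beta] is defined with the shape raised by one. *)
Lemma gamma_mean_scale_derive1 (R : realType) (k : nat) (f : R -> R) :
  gamma_integrable k.+2 f ->
  gamma_mean k.+1 (fun v => v * f v) = k.+1%:R * gamma_mean k.+2 f.
Proof.
move=> intf; rewrite /gamma_mean -RintegralZl//.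
apply: eq_Rintegral => v; rewrite mem_setE in_itv/= andbT => v0.
rewrite !gamma_pdfS1E// factS natrM exprS.
field.
by rewrite nat1r !pnatr_eq0 -lt0n fact_gt0.
Qed.

(** By the mean value theorem the increment has the sign of the derivative at some [c] with
    [x < c < y]. As [c] is strictly below [b] even for [y = b], this derivative is negative. *)
Lemma gamma_mean_loss_decreasing (R : realType) (k : nat) (L : R -> R) (b x y : R) :
  (0 < k)%N -> bowl_shaped_loss L -> regular_loss k L ->
  unique_positive_root_of_mean k.+1 L b ->
  0 < x -> x < y -> y <= b ->
  gamma_mean k (fun v => L (y * v)) < gamma_mean k (fun v => L (x * v)).
Proof.
case: k => // k _ hL hreg hb x0 xy yb.
pose g' c := gamma_mean k.+1 (fun v => v * derive1 L (c * v)).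
have dg (c : R) : 0 < c ->
    is_derive c 1 (fun x : R => gamma_mean k.+1 (fun v => L (x * v))) (g' c).
  by move=> /hreg[].
have [||c] := @MVT R (fun x => gamma_mean k.+1 (fun v => L (x * v))) g' x y xy.
- move=> c; rewrite in_itv/= => /andP[xc _].
  exact: dg (lt_trans x0 xc).
- apply: derivable_within_continuous => c; rewrite in_itv/= => /andP[xc _].
  exact: (@ex_derive _ _ _ _ _ _ _ (dg _ (lt_le_trans x0 xc))).
rewrite in_itv/= => /andP[xc cy] E.
rewrite -subr_lt0 E pmulr_llt0 ?subr_gt0//.
have c0 := lt_trans x0 xc.
rewrite /g' (gamma_mean_scale_derive1 (f := fun v => derive1 L (c * v))).
  rewrite pmulr_rlt0//.
  apply: gamma_mean_derive1_lt0 hb c0 (lt_le_trans cy yb) => // z z0.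
  by have [] := hreg _ z0.
by have [] := hreg _ c0.
Qed.

(** * Measurability on the half-line and strict comparison of integrals *)

Lemma measurable_fun_derivable_gt0 (R : realType) (f : R -> R) :
  (forall t, 0 < t -> derivable f t 1) ->
  measurable_fun (`]0, +oo[ : set R) f.
Proof.
move=> df; apply: subspace_continuous_measurable_fun => //.
apply: derivable_within_continuous => x; rewrite in_itv/= andbT.
exact: df.
Qed.

Lemma measurable_fun_inv_gt0 d (T : measurableType d) (R : realType) (D : set T)
    (f : T -> R) :
  (forall x, D x -> 0 < f x) -> measurable_fun D f ->
  measurable_fun D (fun x => (f x)^-1).
Proof.
move=> f0 mf.
have minv : measurable_fun (`]0, +oo[ : set R) (fun x : R => x^-1).
  apply: measurable_fun_derivable_gt0 => t t0.
  by apply: derivableV => //; rewrite gt_eqF.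
apply: (measurable_comp _ _ minv mf) => // _ [x Dx <-] /=.
by rewrite in_itv/= andbT f0.
Qed.

(** If the integrals were equal, their finiteness would allow cancellation, and the nonnegative
    function [g - f] would have integral zero, hence vanish almost everywhere on [D]. *)
Lemma ge0_integral_lt d (T : measurableType d) (R : realType)
    (mu : {measure set T -> \bar R}) (D : set T) (f g : T -> R) :
  measurable D -> measurable_fun D f -> measurable_fun D g ->
  (forall x, D x -> 0 <= f x) -> (forall x, D x -> f x <= g x) ->
  (\int[mu]_(x in D) (g x)%:E < +oo)%E ->
  mu (D `&` [set x | f x < g x]) <> 0%E ->
  (\int[mu]_(x in D) (f x)%:E < \int[mu]_(x in D) (g x)%:E)%E.
Proof.
move=> mD mf mg f0 fg g_fin fgN0.
have mfE : measurable_fun D (EFin \o f) by exact/measurable_EFinP.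
have mgE : measurable_fun D (EFin \o g) by exact/measurable_EFinP.
have mgf : measurable_fun D (fun x => g x - f x) by exact: measurable_funB.
have mgfE : measurable_fun D (fun x => (g x - f x)%:E) by exact/measurable_EFinP.
have fg_le : (\int[mu]_(x in D) (f x)%:E <= \int[mu]_(x in D) (g x)%:E)%E.
  by apply: ge0_le_integral => // x Dx; rewrite lee_fin ?f0 ?fg// (le_trans (f0 _ Dx))// fg.
have f_fin : (\int[mu]_(x in D) (f x)%:E)%E \is a fin_num.
  rewrite ge0_fin_numE; first exact: le_lt_trans g_fin.
  by apply: integral_ge0 => x Dx; rewrite lee_fin f0.
rewrite lt_neqAle fg_le andbT; apply/negP => /eqP fgE; apply: fgN0.
have gE : (\int[mu]_(x in D) (g x)%:E = \int[mu]_(x in D) (f x)%:E +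
    \int[mu]_(x in D) (g x - f x)%:E)%E.
  rewrite -ge0_integralD//.
  - by apply: eq_integral => x _; rewrite -EFinD addrC subrK.
  - by move=> x Dx; rewrite lee_fin subr_ge0 fg.
have gf0 : (\int[mu]_(x in D) (g x - f x)%:E = 0)%E.
  rewrite -[LHS](addeK _ f_fin) addeC [X in (_ + X)%E]addeC -gE -fgE.
  by rewrite addeC subee.
have : ae_eq mu D (fun x => (g x - f x)%:E) (cst 0%E).
  apply/ae_eq_integral_abs => //; rewrite -[RHS]gf0.
  by apply: eq_integral => x; rewrite inE => Dx; rewrite gee0_abs// lee_fin subr_ge0 fg.
(* The exceptional set of the almost everywhere equality is exactly the set where [f < g]; it is
   measurable, so negligibility means measure zero. *)
move=> /negligibleP h; rewrite -[RHS]h.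
  congr (mu _); apply/seteqP; split => x /=.
    move=> [Dx fgx] /(_ Dx) [/eqP]; rewrite subr_eq0 => /eqP gfx.
    by rewrite gfx ltxx in fgx.
  move=> /not_implyP[Dx gfN]; split => //.
  rewrite lt_neqAle fg// andbT; apply/eqP => fgx; apply: gfN.
  by rewrite fgx subrr.
rewrite [X in measurable X](_ : _ = D `&` [set x | (g x - f x)%:E != 0%E]).
  exact: emeasurable_neq.
apply/seteqP; split => x /=.
  by move=> /not_implyP[Dx /eqP].
by move=> [Dx /eqP ?]; exact/not_implyP.
Qed.

Lemma measurable_ratio_rate (R : realType) (s1 s2 : R) :
  measurable_fun (`]0, +oo[ : set R) (ratio_rate s1 s2).
Proof. by apply: measurable_funD => //; exact: measurable_funM. Qed.

Lemma measurable_ratio_weight (R : realType) (k1 k2 : nat) (s1 s2 : R) :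
  0 < s1 -> 0 < s2 ->
  measurable_fun (`]0, +oo[ : set R) (ratio_weight k1 k2 s1 s2).
Proof.
move=> s10 s20; apply: measurable_funM; last first.
  apply: measurable_fun_inv_gt0 => [z /=|].
    by rewrite in_itv/= andbT => z0; rewrite exprn_gt0// ratio_rate_gt0.
  by apply: measurable_funX; exact: measurable_ratio_rate.
apply: measurable_funM => //; apply: measurable_funM => //. 
Qed.

Lemma gamma_mean_fineK (R : realType) (k : nat) (f : R -> R) :
  gamma_integrable k f ->
  (gamma_mean k f)%:E =
  (\int[lebesgue_measure]_(u in `]0%R, +oo[) (f u * gamma_pdf k 1 u)%:E)%E.
Proof. by move=> intf; rewrite /gamma_mean /Rintegral fineK// integrable_fin_num. Qed.

Lemma gamma_mean_ge0 (R : realType) (k : nat) (f : R -> R) :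
  (forall u, 0 < u -> 0 <= f u) -> 0 <= gamma_mean k f.
Proof.
move=> f0; apply: Rintegral_ge0 => u /=; rewrite in_itv/= andbT => u0.
by rewrite mulr_ge0 ?f0// gamma_pdf_ge0.
Qed.

(** * The risk as an integral over the values of the ratio *)

Lemma censored_exponential_model_indep d (T : measurableType d) (R : realType)
    (n1 n2 a1 a2 b1 b2 : nat) (P : param R -> probability T R)
    (XA1 XA2 V1 V2 : {mfun T >-> R}) (theta : param R) (A B : set R) :
  censored_exponential_model n1 n2 a1 a2 b1 b2 P XA1 XA2 V1 V2 ->
  admissible theta -> measurable A -> measurable B ->
  P theta (V1 @^-1` A `&` V2 @^-1` B) =
  (P theta (V1 @^-1` A) * P theta (V2 @^-1` B))%E.
Proof.
move=> hm ht mA mB; have [_ _ _ _ indep] := hm _ ht.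
have := indep setT setT A B measurableT measurableT mA mB.
by rewrite !preimage_setT !setTI !probability_setT !mul1e.
Qed.

(** Given the ratio [z], [V2] is a standard gamma variable of shape [k1 + k2] divided by
    [ratio_rate]. The denominator [sigma2 * ratio_rate] equals [1 + z / eta]. *)
Lemma risk_gamma_meanE d (T : measurableType d) (R : realType)
    (P : param R -> probability T R) (V1 V2 : {mfun T >-> R}) (k1 k2 : nat)
    (L phi : R -> R) (theta : param R) :
  (0 < k1)%N -> (0 < k2)%N -> admissible theta ->
  has_density (P theta) V1 (gamma_pdf k1 (sigma1 theta)) ->
  has_density (P theta) V2 (gamma_pdf k2 (sigma2 theta)) ->
  (forall A B : set R, measurable A -> measurable B ->
     P theta (V1 @^-1` A `&` V2 @^-1` B) =
     (P theta (V1 @^-1` A) * P theta (V2 @^-1` B))%E) ->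
  bowl_shaped_loss L ->
  (forall c, 0 < c -> gamma_integrable (k1 + k2) (fun v => L (c * v))) ->
  measurable_fun (`]0, +oo[ : set R) phi ->
  (forall z, 0 < z -> 0 < phi z) ->
  risk P V1 V2 L theta phi =
  (\int[lebesgue_measure]_(z in `]0%R, +oo[)
    (ratio_weight k1 k2 (sigma1 theta) (sigma2 theta) z *
     gamma_mean (k1 + k2) (fun v => L (phi z /
       (sigma2 theta * ratio_rate (sigma1 theta) (sigma2 theta) z) * v)))%:E)%E.
Proof.
move=> k10 k20 [s10 s12] d1 d2 indep hL intL mphi phi0.
have s20 := lt_le_trans s10 s12.
set s1 := sigma1 theta in s10 s12 d1 *; set s2 := sigma2 theta in s12 s20 d2 *.
have m0 : measurable (`]0%R, +oo[ : set R) by [].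
(* [L] and [phi] are controlled only on the positive half-line. Their extensions by zero are
   measurable on the whole line, [Lp] is nonnegative, and on [positive_part] the loss is
   unchanged. *)
pose Lp := L \_ `]0, +oo[%classic; pose phip := phi \_ `]0, +oo[%classic.
have LpE t : 0 < t -> Lp t = L t.
  by move=> t0; rewrite /Lp patchE mem_setE in_itv/= t0.
have phipE z : 0 < z -> phip z = phi z.
  by move=> z0; rewrite /phip patchE mem_setE in_itv/= z0.
have mLp : measurable_fun [set: R] Lp.
  apply/(measurable_restrictT _ m0); apply: measurable_fun_derivable_gt0.
  by case: hL.
have mphip : measurable_fun [set: R] phip by exact/(measurable_restrictT _ m0).
have Lp0 t : 0 <= Lp t.
  rewrite /Lp patchE mem_setE in_itv/= andbT; case: ifPn => // t0.
  exact: bowl_shaped_loss_ge0.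
pose G (z : R * R) : \bar R := (Lp (z.2 * phip z.1 / s2))%:E.
have mG : measurable_fun [set: R * R] G.
  apply/measurable_EFinP; apply: measurableT_comp => //.
  apply: measurable_funM => //; apply: measurable_funM => //.
  exact: measurableT_comp.
transitivity (\int[P theta]_(w in positive_part V1 V2)
    G (Zstar V1 V2 w, V2 w))%E.
  apply: eq_integral => w; rewrite inE => -[V10 V20].
  have Z0 : 0 < Zstar V1 V2 w by rewrite divr_gt0.
  by rewrite /G /= phipE// LpE// !mulr_gt0 ?invr_gt0// phi0.
rewrite (ge0_integral_gamma_ratio k10 k20 s10 s20 d1 d2)//; last first.
  by move=> z; rewrite lee_fin.
apply: eq_integral => z; rewrite inE /= in_itv/= andbT => z0.
have r0 := ratio_rate_gt0 s10 s20 z0; set r := ratio_rate s1 s2 z in r0 *.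
have c0 : 0 < phi z / (s2 * r) by rewrite divr_gt0 ?mulr_gt0 ?phi0.
rewrite [RHS]EFinM gamma_mean_fineK; last exact: intL.
congr (_ * _)%E; rewrite [RHS]integral_mkcond; apply: eq_integral => u _.
rewrite patchE mem_setE in_itv/= andbT; case: ifPn => [u0|].
  rewrite /G/= phipE// [(u / r * _ / s2)%R](_ : _ = phi z / (s2 * r) * u)%R.
    by rewrite LpE -?EFinM// mulr_gt0.
  by field; rewrite !gt_eqF.
by rewrite -leNgt => u0; rewrite gamma_pdf_le0// mule0.
Qed.

Lemma measurable_risk_integrand (R : realType) (k1 k2 : nat) (s1 s2 : R)
    (g phi : R -> R) :
  0 < s1 -> 0 < s2 ->
  measurable_fun (`]0, +oo[ : set R) g ->
  measurable_fun (`]0, +oo[ : set R) phi ->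
  (forall z, 0 < z -> 0 < phi z) ->
  measurable_fun (`]0, +oo[ : set R)
    (fun z => ratio_weight k1 k2 s1 s2 z * g (phi z / (s2 * ratio_rate s1 s2 z))).
Proof.
move=> s10 s20 mg mphi phi0.
apply: measurable_funM; first exact: measurable_ratio_weight.
have mc : measurable_fun (`]0, +oo[ : set R)
    (fun z => phi z / (s2 * ratio_rate s1 s2 z)).
  apply: measurable_funM => //; apply: measurable_fun_inv_gt0 => [z /=|].
    by rewrite in_itv/= andbT => z0; rewrite mulr_gt0// ratio_rate_gt0.
  by apply: measurable_funM => //; exact: measurable_ratio_rate.
apply: (measurable_comp _ _ mg mc) => // _ [z /= + <-].
by rewrite !in_itv/= !andbT => z0; rewrite divr_gt0 ?phi0// mulr_gt0// ratio_rate_gt0.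
Qed.

(** The law of the ratio has a density on the half-line. In contrapositive form, an event on the
    ratio that has positive probability under one parameter comes from a set of positive Lebesgue
    measure, a property free of the parameter. *)
Lemma ratio_null_set d (T : measurableType d) (R : realType)
    (P : probability T R) (X Y : {mfun T >-> R}) (k1 k2 : nat) (s1 s2 : R)
    (B : set R) :
  (0 < k1)%N -> (0 < k2)%N -> 0 < s1 -> 0 < s2 ->
  has_density P X (gamma_pdf k1 s1) -> has_density P Y (gamma_pdf k2 s2) ->
  (forall A B : set R, measurable A -> measurable B ->
     P (X @^-1` A `&` Y @^-1` B) = (P (X @^-1` A) * P (Y @^-1` B))%E) ->
  measurable B -> B `<=` `]0, +oo[ -> lebesgue_measure B = 0%E ->
  P (positive_part X Y `&` Zstar X Y @^-1` B) = 0%E.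
Proof.
move=> k10 k20 s10 s20 dX dY XY mB B0 muB.
pose G (z : R * R) : \bar R := (\1_B z.1)%:E.
have mG : measurable_fun [set: R * R] G.
  by apply/measurable_EFinP; apply: measurableT_comp => //; exact: measurable_indic.
have G0 z : (0 <= G z)%E by rewrite lee_fin.
have mpos : measurable (positive_part X Y).
  rewrite (_ : positive_part X Y = X @^-1` `]0, +oo[ `&` Y @^-1` `]0, +oo[).
    by apply: measurableI; rewrite -[X in measurable X]setTI; exact: measurable_funP.
  by apply/seteqP; split => w /=; rewrite !in_itv/= !andbT.
have mZ : measurable_fun (positive_part X Y) (Zstar X Y).
  apply: measurable_funM; first exact: measurable_funTS.
  by apply: measurable_fun_inv_gt0 => [w []//|]; exact: measurable_funTS.
(* The probability is the integral of the indicator of [B], as a function of the ratio alone. *)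
transitivity (\int[P]_(w in positive_part X Y) G (Zstar X Y w, Y w))%E.
  rewrite -[LHS]mul1e -integral_cst; last exact: mZ.
  rewrite integral_mkcondr; apply: eq_integral => w _.
  by rewrite patchE /G /= indicE; case: ifPn; rewrite ?inE ?notin_setE /= => Bw;
    rewrite ?(mem_set Bw) ?(memNset Bw).
rewrite (ge0_integral_gamma_ratio k10 k20 s10 s20 dX dY)//.
pose C := (\int[lebesgue_measure]_u (gamma_pdf (k1 + k2) 1 u : R)%:E)%E.
transitivity (\int[lebesgue_measure]_(z in `]0%R, +oo[ `&` B)
    ((ratio_weight k1 k2 s1 s2 z)%:E * C))%E.
  rewrite integral_mkcondr; apply: eq_integral => z _.
  rewrite patchE /G /= indicE; case: ifPn => Bz.
    by congr (_ * _)%E; apply: eq_integral => u _; rewrite mul1e.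
  by rewrite integral0_eq ?mule0// => u _; rewrite mul0e.
rewrite setIidr// null_set_integral//.
apply: emeasurable_funM => //; apply/measurable_EFinP.
exact: (measurable_funS _ B0 (measurable_ratio_weight k1 k2 s10 s20)).
Qed.

(** * Strict domination for every admissible parameter *)

Unset Implicit Arguments.
Set Strict Implicit.

Theorem theorem3p1 (R : realType) (d : measure_display) (T : measurableType d)
    (n1 n2 a1 a2 b1 b2 : nat)
    (ha1 : (1 <= a1)%N) (hab1 : (a1 < b1)%N) (hbn1 : (b1 <= n1)%N)
    (ha2 : (1 <= a2)%N) (hab2 : (a2 < b2)%N) (hbn2 : (b2 <= n2)%N)
    (P : param R -> probability T R) (XA1 XA2 V1 V2 : {mfun T >-> R})
    (hmodel : censored_exponential_model n1 n2 a1 a2 b1 b2 P XA1 XA2 V1 V2)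
    (L : R -> R) (hL : bowl_shaped_loss L)
    (hreg : regular_loss (b1 + b2 - (a1 + a2)) L)
    (phi1 : R -> R) (mphi1 : measurable_fun (`]0, +oo[ : set R) phi1)
    (phi1_gt0 : forall z, 0 < z -> 0 < phi1 z)
    (hfin : forall theta, admissible theta ->
       (risk P V1 V2 L theta phi1 < +oo)%E)
    (beta : R)
    (hbeta : unique_positive_root_of_mean (b1 + b2 - (a1 + a2)).+1 L beta)
    (hprob : exists2 e : R, 0 < e &
       exists theta0 : param R,
         [/\ admissible theta0, eta theta0 = e &
             P theta0 (positive_part V1 V2 `&`
               [set w | phi1 (Zstar V1 V2 w) < c1 beta (Zstar V1 V2 w)])
             <> 0%E]) :
  forall theta : param R, admissible theta ->
    (risk P V1 V2 L theta (phi21 beta phi1) < risk P V1 V2 L theta phi1)%E.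
Proof.
have k1gt0 : (0 < b1 - a1)%N by rewrite subn_gt0.
have k2gt0 : (0 < b2 - a2)%N by rewrite subn_gt0.
have kE : (b1 + b2 - (a1 + a2) = (b1 - a1) + (b2 - a2))%N.
  by rewrite subnDA addnC -addnBA ?(ltnW hab1)// addnC addnBA// ltnW.
rewrite kE in hreg hbeta.
set k1 := (b1 - a1)%N in k1gt0 kE hreg hbeta; set k2 := (b2 - a2)%N in k2gt0 kE hreg hbeta.
have kgt0 : (0 < k1 + k2)%N by rewrite addn_gt0 k1gt0.
have beta0 : 0 < beta by case: hbeta.
have c1gt0 z : 0 < z -> 0 < c1 beta z.
  by move=> z0; rewrite mulr_gt0// addr_gt0.
have mc1 : measurable_fun (`]0, +oo[ : set R) (c1 beta).
  by apply: measurable_funM => //; exact: measurable_funD.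
have mphi2 : measurable_fun (`]0, +oo[ : set R) (phi21 beta phi1).
  exact: measurable_maxr.
have phi2_gt0 z : 0 < z -> 0 < phi21 beta phi1 z.
  by move=> z0; rewrite lt_max phi1_gt0.
have intL c : 0 < c -> gamma_integrable (k1 + k2) (fun v => L (c * v)).
  by move=> /hreg[].
pose g c := gamma_mean (k1 + k2) (fun v => L (c * v)).
have mg : measurable_fun (`]0, +oo[ : set R) g.
  apply: measurable_fun_derivable_gt0 => c c0; have [_ _ dc] := hreg _ c0.
  exact: (@ex_derive _ _ _ _ _ _ _ dc).
have g_ge0 c : 0 < c -> 0 <= g c.
  by move=> c0; apply: gamma_mean_ge0 => u u0; rewrite bowl_shaped_loss_ge0// mulr_gt0.
pose B : set R := `]0, +oo[ `&` [set z | phi1 z < c1 beta z].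
have mB : measurable B.
  rewrite /B (_ : [set z | _] = (fun z => phi1 z < c1 beta z) @^-1` [set true]) //.
  exact: measurable_fun_ltr.
(* The assumption at the single parameter [th0] is turned into a statement about [B] alone, which
   then serves every [theta]. *)
have muB : lebesgue_measure B <> 0%E.
  move=> muB; have [e _ [th0 [adm0 _]]] := hprob; apply.
  have [_ _ d1 d2 _] := hmodel _ adm0; have [s10 s12] := adm0.
  have s20 := lt_le_trans s10 s12.
  rewrite -[RHS](ratio_null_set k1gt0 k2gt0 s10 s20 d1 d2 _ mB _ muB) => [|A A' mA mA'|z []//].
    congr (P th0 _); apply/seteqP; split => w /= [[V10 V20]].
      by move=> h; split => //; split => //=; rewrite in_itv/= andbT divr_gt0.
    by move=> [_ h]; split.
  exact: (censored_exponential_model_indep hmodel).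
move=> theta adm; have [_ _ d1 d2 _] := hmodel _ adm; have [s10 s12] := adm.
have s20 := lt_le_trans s10 s12.
have indep A A' := @censored_exponential_model_indep _ _ _ _ _ _ _ _ _ _ _ _ _ _ _ A A' hmodel adm.
have risk2E := risk_gamma_meanE k1gt0 k2gt0 adm d1 d2 indep hL intL mphi2 phi2_gt0.
have risk1E := risk_gamma_meanE k1gt0 k2gt0 adm d1 d2 indep hL intL mphi1 phi1_gt0.
have fin := hfin _ adm; rewrite risk1E in fin; rewrite risk2E risk1E.
have arg_gt0 (phi : R -> R) z : (forall z, 0 < z -> 0 < phi z) -> 0 < z ->
    0 < phi z / (sigma2 theta * ratio_rate (sigma1 theta) (sigma2 theta) z).
  by move=> phi0 z0; rewrite divr_gt0 ?phi0// mulr_gt0// ratio_rate_gt0.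
have g_lt z : B z ->
    g (phi21 beta phi1 z / (sigma2 theta * ratio_rate (sigma1 theta) (sigma2 theta) z)) <
    g (phi1 z / (sigma2 theta * ratio_rate (sigma1 theta) (sigma2 theta) z)).
  rewrite /B /= in_itv/= andbT => -[z0 phi1z].
  have -> : phi21 beta phi1 z = c1 beta z by apply/max_idPr; exact: ltW.
  have r0 : 0 < sigma2 theta * ratio_rate (sigma1 theta) (sigma2 theta) z.
    by rewrite mulr_gt0// ratio_rate_gt0.
  apply: (gamma_mean_loss_decreasing kgt0 hL hreg hbeta); first exact: arg_gt0.
    by rewrite ltr_pM2r ?invr_gt0.
  (* The bound to prove is [1 + z <= 1 + z / eta], which follows from [sigma1 <= sigma2]. *)
  rewrite ler_pdivrMr// /c1 ler_pM2l// /ratio_rate mulrDr mulfV ?gt_eqF//.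
  by rewrite addrC lerD2r mulrA ler_pdivlMr// mulrC ler_pM2r.
have g_le z : 0 < z ->
    g (phi21 beta phi1 z / (sigma2 theta * ratio_rate (sigma1 theta) (sigma2 theta) z)) <=
    g (phi1 z / (sigma2 theta * ratio_rate (sigma1 theta) (sigma2 theta) z)).
  (* Outside [B] the two estimators coincide. *)
  move=> z0; have [c1phi|phic1] := leP (c1 beta z) (phi1 z).
    by rewrite /phi21 (max_idPl c1phi).
  by apply/ltW/g_lt; split => //=; rewrite in_itv/= z0.
have w_gt0 z : 0 < z -> 0 < ratio_weight k1 k2 (sigma1 theta) (sigma2 theta) z.
  exact: ratio_weight_gt0.
apply: ge0_integral_lt => //.
- exact: (@measurable_risk_integrand _ _ _ _ _ g).
- exact: (@measurable_risk_integrand _ _ _ _ _ g).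
- move=> z /=; rewrite in_itv/= andbT => z0.
  by rewrite mulr_ge0 ?(ltW (w_gt0 _ _))// g_ge0// arg_gt0.
- move=> z /=; rewrite in_itv/= andbT => z0.
  by rewrite ler_pM2l ?w_gt0// g_le.
(* As the weight is positive, the two integrands differ strictly exactly on [B], which is not a null
   set. *)
apply: contra_not muB => mu0.
rewrite -[LHS]/(lebesgue_measure B) (_ : B = `]0, +oo[ `&` [set z |
  ratio_weight k1 k2 (sigma1 theta) (sigma2 theta) z * g (phi21 beta phi1 z /
    (sigma2 theta * ratio_rate (sigma1 theta) (sigma2 theta) z)) <
  ratio_weight k1 k2 (sigma1 theta) (sigma2 theta) z * g (phi1 z /
    (sigma2 theta * ratio_rate (sigma1 theta) (sigma2 theta) z))])//.
apply/seteqP; split => z [/= zpos]; move: (zpos); rewrite in_itv/= andbT => z0 h; split => //.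
  by rewrite ltr_pM2l ?w_gt0// g_lt.
rewrite /= ltNge; apply/negP => c1phi; move: h.
by rewrite /phi21 (max_idPl c1phi) ltxx.
Qed.
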